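(* Let $\mathcal{G}$ be a connected graph on $N$ vertices with diameter $D$. Suppose there exists a matrix $M\in\mathcal{M}(\mathcal{G})$ such that the following three conditions are satisfied: (a) there exists $k\in\mathbb{R}$ such that $\ker(M-kI)=\ker(M^{T}-kI)=\{\alpha\mathbf{1} : \alpha\in\mathbb{R}\}$; (b) the minimal polynomial $m_M(x)$ of $M$ has degree $D+1$; (c) $M$ has real eigenvalues, i.e., the roots $k,\lambda_1,\dots,\lambda_D$ of $m_M(x)$ (listed with multiplicity) are real. Then the $D$ matrices $M-\lambda_t I$, $t=1,\dots,D$, are in $\mathcal{M}(\mathcal{G})$, and their product in any order is equal to a multiple of $\mathbf{1}\mathbf{1}^{T}$.
   Context: Graphs are finite, simple and undirected. For a graph $\mathcal{G}=(\mathcal{V},\mathcal{E})$ with vertices $1,\dots,N$, the set of matrices that comply with $\mathcal{G}$ is $$\mathcal{M}(\mathcal{G}) = \{A=[a_{ij}]\in\mathbb{R}^{N\times N} : \text{for all } i\neq j,\ (i,j)\notin\mathcal{E} \Rightarrow a_{ij}=0\}.$$ The vector $\mathbf{1}\in\mathbb{R}^N$ is the column vector of ones, and $I$ is the $N\times N$ identity matrix. The diameter of a connected graph is the maximum, over pairs of vertices, of the length of a shortest path between them. The minimal polynomial $m_M(x)$ is the monic polynomial $p$ of least degree such that $p(M)=0$. *)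

(* Defs.v *)
From HB Require Import structures.
From mathcomp Require Import all_boot all_order all_fingroup all_algebra.
From mathcomp Require Import reals.

Set Implicit Arguments.
Unset Strict Implicit.
Unset Printing Implicit Defensive.

Import Order.TTheory GRing.Theory Num.Theory.
Local Open Scope ring_scope.

Record sgraph (T : finType) := SGraph {
  adj :> rel T;
  adj_sym : symmetric adj;
  adj_irr : irreflexive adj }.

Section Distance.
Local Open Scope nat_scope.
Variables (T : finType) (G : sgraph T).

Definition connected_graph : Prop := forall x y : T, connect G x y.

Definition has_path_of_length (x y : T) (l : nat) : bool :=
  [exists p : l.-tuple T, [&& path G x p, uniq (x :: p) & last x p == y]].

(* A path has at most #|T| - 1 edges, so searching l < #|T| is exhaustive;
   the value is #|T| when x and y are not connected. *)
Definition gdist (x y : T) : nat :=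
  find (has_path_of_length x y) (iota 0 #|T|).

Definition diameter : nat := \max_(x : T) \max_(y : T) gdist x y.

Lemma gdistP (x y : T) : connect G x y ->
  has_path_of_length x y (gdist x y) /\
  forall l, has_path_of_length x y l -> gdist x y <= l.
Proof.
have bnd l : has_path_of_length x y l -> l < #|T|.
  case/existsP=> p /and3P[_ /card_uniqP + _].
  by rewrite /= size_tuple => <-; apply: max_card.
move=> /connectP[q pq yE].
have hq : has (has_path_of_length x y) (iota 0 #|T|).
  case/shortenP: pq yE => p pp up _ ->.
  have hp : has_path_of_length x (last x p) (size p).
    by apply/existsP; exists (in_tuple p); rewrite pp up /=.
  apply/hasP; exists (size p); last by [].
  rewrite mem_iota /=; have /card_uniqP/= <- := up.
  exact: max_card.
split=> [|l hl].
  have := nth_find 0 hq; rewrite nth_iota //.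
  by move: hq; rewrite has_find size_iota.
rewrite leqNgt; apply/negP => lt_l.
have := before_find 0 lt_l.
by rewrite nth_iota ?bnd // add0n hl.
Qed.

End Distance.

Definition complies (R : realType) (N : nat) (G : sgraph 'I_N) (A : 'M[R]_N)
  : Prop :=
  forall i j : 'I_N, i != j -> ~~ G i j -> A i j = 0.

Definition ones (R : realType) (N : nat) : 'cV[R]_N := const_mx 1.
Arguments ones {R N}.

(* Stated on column vectors, since MathComp's [kermx] is the kernel of the
   action on row vectors. *)
Definition ker_is_span_ones (R : realType) (N : nat) (A : 'M[R]_N) : Prop :=
  forall v : 'cV[R]_N, A *m v = 0 <-> exists a : R, v = a *: ones.

(* Main.v *)
(** Any ordering of the product is q(M) with q(x) = m_M(x) / (x - k), so it is
    annihilated by M - kI on both sides.  The kernel hypothesis on M then makes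
    all its rows equal, and the one on M^T makes all its columns equal. *)
Require Import Defs.
From HB Require Import structures.
From mathcomp Require Import all_boot all_order all_fingroup all_algebra.
From mathcomp Require Import reals.

Set Implicit Arguments.
Unset Strict Implicit.
Unset Printing Implicit Defensive.

Import Order.TTheory GRing.Theory Num.Theory.
Local Open Scope ring_scope.

Lemma complies_sub_scalar (R : realType) (N : nat) (G : sgraph 'I_N)
    (A : 'M[R]_N) (a : R) : complies G A -> complies G (A - a%:M).
Proof.
by move=> cA i j ij Gij; rewrite !mxE cA // (negbTE ij) mulr0n subr0.
Qed.

(** Each column of [P] lies in the kernel of [A], so it is a multiple of [ones] and has constant
    entries. *)
Lemma ker_is_span_ones_eq_rows (R : realType) (N m : nat) (A : 'M[R]_N)
    (P : 'M[R]_(N, m)) :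
  ker_is_span_ones A -> A *m P = 0 -> forall i i' j, P i j = P i' j.
Proof.
move=> kerA AP0 i i' j.
have /kerA[a /matrixP Pj] : A *m col j P = 0 by rewrite colE mulmxA AP0 mul0mx.
by have := Pj i 0; have := Pj i' 0; rewrite !mxE => -> ->.
Qed.

Theorem theorem3 (R : realType) (n D : nat) (G : sgraph 'I_n.+1)
    (G_conn : connected_graph G) (G_diam : diameter G = D)
    (M : 'M[R]_n.+1) (M_compl : complies G M)
    (k : R)
    (ker_M : ker_is_span_ones (M - k%:M))
    (ker_MT : ker_is_span_ones (M^T - k%:M))
    (deg_M : size (mxminpoly M) = D.+2)
    (lambda : 'I_D -> R)
    (roots_M : mxminpoly M =
       ('X - k%:P) * \prod_(t < D) ('X - (lambda t)%:P)) :
  (forall t : 'I_D, complies G (M - (lambda t)%:M)) /\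
  (forall s : {perm 'I_D}, exists c : R,
     \prod_(t < D) (M - (lambda (s t))%:M) = c *: (ones *m ones^T)).
Proof.
split=> [t|s]; first exact: complies_sub_scalar.
have hX a : horner_mx M ('X - a%:P) = M - a%:M.
  by rewrite rmorphB /= horner_mx_X horner_mx_C.
pose q := \prod_(t < D) ('X - (lambda t)%:P).
set P := \prod_(t < D) _.
have PE : P = horner_mx M q.
  (* The order [s] is absorbed here, among commuting polynomial factors, before passing to
     matrices. *)
  rewrite /q (reindex_inj (@perm_inj _ s)) rmorph_prod.
  by apply: eq_bigr => t _; rewrite /= hX.
have MP0 : (M - k%:M) *m P = 0.
  by rewrite PE -hX mulmxE -rmorphM /= -roots_M mx_root_minpoly.
have PM0 : P *m (M - k%:M) = 0.
  by rewrite PE -hX mulmxE -rmorphM /= mulrC -roots_M mx_root_minpoly.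
(* Transposing [PM0] puts the factor on the left, so that [ker_MT] applies to the columns of
   [P^T]. *)
have MTP0 : (M^T - k%:M) *m P^T = 0.
  by rewrite -(tr_scalar_mx _ k) -linearB -trmx_mul PM0 trmx0.
(* Equal rows move the entry [(i, j)] to [(0, j)]; equal columns then move it to [(0, 0)]. *)
exists (P 0 0); apply/matrixP=> i j.
rewrite (ker_is_span_ones_eq_rows ker_M MP0 i 0).
have := ker_is_span_ones_eq_rows ker_MT MTP0 j 0 0; rewrite !mxE => ->.
by rewrite big_ord1 !mxE !mulr1.
Qed.
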